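(* Let $m\geq 2$ be an integer with $m\neq 4$, and let $D_{2m}=\langle a,b\mid a^m=b^2=1,\ b^{-1}ab=a^{-1}\rangle$ be the dihedral group of order $2m$. Then the Chermak-Delgado lattice $\mathcal{CD}(D_{2m})$ is a chain of length $0$, i.e. it consists of exactly one subgroup.
   Context: For a finite group $G$ and a subgroup $H\leq G$, the Chermak-Delgado measure of $H$ is $m_G(H)=|H|\,|C_G(H)|$, where $C_G(H)$ is the centralizer of $H$ in $G$. Set $m(G)=\max\{m_G(H)\mid H\leq G\}$ and $\mathcal{CD}(G)=\{H\leq G\mid m_G(H)=m(G)\}$; this set is a sublattice of the subgroup lattice of $G$, called the Chermak-Delgado lattice of $G$. *)

(* Defs.v *)
From mathcomp Require Import all_boot all_fingroup.

Set Implicit Arguments.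
Unset Strict Implicit.
Unset Printing Implicit Defensive.

Local Open Scope group_scope.

Definition cd_measure (gT : finGroupType) (G H : {group gT}) : nat :=
  (#|H| * #|'C_G(H)|)%N.

Definition max_cd_measure (gT : finGroupType) (G : {group gT}) : nat :=
  \max_(H in subgroups G) cd_measure G H.

(* The lattice is represented by its underlying set, ordered by \subset. *)
Definition CD (gT : finGroupType) (G : {group gT}) : {set {group gT}} :=
  [set H in subgroups G | cd_measure G H == max_cd_measure G].

(* The length of a finite chain is its number of elements minus one. *)
Definition chain_of_length (gT : finGroupType) (n : nat)
    (L : {set {group gT}}) : Prop :=
  (forall H K : {group gT}, H \in L -> K \in L -> (H \subset K) || (K \subset H))
  /\ #|L| = n.+1.

(* Main.v *)
Require Import Defs.
From mathcomp Require Import all_boot all_fingroup.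
From mathcomp Require Import all_solvable zify.

Set Implicit Arguments.
Unset Strict Implicit.
Unset Printing Implicit Defensive.

Local Open Scope group_scope.

(** Let [A] be the rotation subgroup, of order [m] and index 2. Every element
outside [A] inverts [A], so it centralizes only the elements of [A] of square 1,
and these form a subgroup of order less than [m / 2] as soon as [m > 2] and
[m <> 4]. Splitting according to whether [H] and its centralizer lie in [A], this
forces [|H| |C(H)| < m^2 <= |A| |C(A)|] for every [H] other than [A].
For [m = 2] the group is abelian and is itself the unique maximizer. *)

Lemma CD_eq_set1 (gT : finGroupType) (G A : {group gT}) :
    A \subset G ->
    (forall H : {group gT}, H \subset G -> H :!=: A ->
       (cd_measure G H < cd_measure G A)%N) ->
  CD G = [set A].
Proof.
move=> sAG ltA.
have maxA: max_cd_measure G = cd_measure G A.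
  apply/eqP; rewrite eqn_leq leq_bigmax_cond ?inE // andbT.
  apply/bigmax_leqP=> H; rewrite inE => sHG.
  by have [/group_inj-> // | /ltA/ltnW->] := eqVneq (H : {set gT}) A.
apply/setP=> H; rewrite !inE maxA.
apply/andP/eqP=> [[sHG eqHA] | ->]; last by rewrite sAG.
apply/group_inj/eqP; apply: contraLR eqHA => neqHA.
by rewrite neq_ltn ltA.
Qed.

Lemma abelian_CD (gT : finGroupType) (G : {group gT}) :
  abelian G -> CD G = [set G].
Proof.
move=> cGG; apply: CD_eq_set1 => // H sHG neqHG.
have sCG (K : {group gT}) : K \subset G -> 'C_G(K) = G.
  by move=> sKG; apply/setIidPl; apply: subset_trans cGG (centS sKG).
by rewrite /cd_measure !sCG // ltn_pmul2r ?cardG_gt0 // proper_card // properEneq neqHG.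
Qed.

(** A cyclic group of exponent dividing 2 has order 1 or 2. In the second case [#|A|] is even, and
    excluding 2 and 4 leaves at least 6. *)
Lemma card_cyclic_involutions (gT : finGroupType) (A K : {group gT}) :
    cyclic A -> (2 < #|A|)%N -> #|A| != 4 -> K \subset A ->
    {in K, forall x, x ^+ 2 = 1} ->
  (2 * #|K| < #|A|)%N.
Proof.
move=> cycA A_gt2 nA4 sKA K2.
have /cyclicP[x defK] := cyclicS sKA cycA.
have dvdK2: #|K| %| 2 by rewrite defK -orderE order_dvdn K2 // defK cycle_id.
have dvdKA := cardSg sKA.
have := dvdn_leq (ltn0Sn 1) dvdK2; have := cardG_gt0 K.
have /dvdnP[q oA] := dvdKA; rewrite oA in A_gt2 nA4 *.
by case: #|K| => [|[|[|k]]] // in A_gt2 nA4 *; lia.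
Qed.

Lemma cd_measure_lt_inverted (gT : finGroupType) (G A H : {group gT}) :
    cyclic A -> (2 < #|A|)%N -> #|A| != 4 ->
    A \subset G -> (#|G| <= 2 * #|A|)%N ->
    {in G :\: A & A, forall y x, x ^ y = x^-1} ->
    H \subset G -> H :!=: A ->
  (cd_measure G H < cd_measure G A)%N.
Proof.
move=> cycA A_gt2 nA4 sAG leGA invA sHG neqHA.
have cdA: (#|A| * #|A| <= cd_measure G A)%N.
  rewrite leq_mul2l subset_leq_card ?orbT // subsetI sAG.
  exact: cyclic_abelian.
apply: leq_trans cdA; rewrite /cd_measure.
(* By the product formula, [#|K| * #|A|] is [#|K * A| * #|K :&: A|], and [K * A] lies in [G], of
   order at most [2 * #|A|]. *)
have cardI (K : {group gT}) : K \subset G -> (#|K| <= 2 * #|K :&: A|)%N.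
  move=> sKG; rewrite -(leq_pmul2r (cardG_gt0 A)) mul_cardG.
  rewrite mulnAC leq_mul2r (leq_trans _ leGA) ?orbT //.
  by rewrite subset_leq_card // mul_subG.
(* An element [y] of [K] outside [A] both fixes and inverts each [x] in [L :&: A], so
   [x ^+ 2 = 1]. *)
have cent_small (K L : {group gT}) : K \subset G -> ~~ (K \subset A) ->
    L \subset 'C(K) -> (2 * #|L :&: A| < #|A|)%N.
  move=> sKG /subsetPn[y Ky nAy] cKL.
  apply: card_cyclic_involutions => //=; first exact: subsetIr.
  move=> x /setIP[Lx Ax]; have := invA y x; rewrite inE nAy (subsetP sKG) //.
  have -> : x ^ y = x by apply/conjg_fixP/commgP/(centsP cKL).
  by move=> /(_ isT Ax) xV; rewrite expgS expg1 {1}xV mulVg.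
set C := 'C_G(H)%G; rewrite -[#|'C_G(H)|]/#|C|.
have sCG: C \subset G by apply: subsetIl.
have cHC: C \subset 'C(H) by apply: subsetIr.
have leHG := subset_leq_card sHG; have leCG := subset_leq_card sCG.
(* [H] and [C] centralize each other, so [cent_small] applies in both directions. If exactly one of
   them lies in [A], its order is below [#|A| / 2], while the other has order at most
   [#|G| <= 2 * #|A|]. *)
have [sHA | nHA] := boolP (H \subset A); have [sCA | nCA] := boolP (C \subset A).
- have ltHA: (#|H| < #|A|)%N by rewrite proper_card // properEneq neqHA.
  by have := subset_leq_card sCA; nia.
- have: H \subset 'C(C) by rewrite centsC.
  by move/(cent_small _ _ sCG nCA); rewrite (setIidPl sHA); nia.
- by have := cent_small _ _ sHG nHA cHC; rewrite (setIidPl sCA); nia.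
(* Neither lies in [A]: [cardI] and [cent_small] make both orders smaller than [#|A|]. *)
have: H \subset 'C(C) by rewrite centsC.
move/(cent_small _ _ sCG nCA); have := cent_small _ _ sHG nHA cHC.
by have := cardI H sHG; have := cardI C sCG; nia.
Qed.

Lemma dihedral_rotations (m : nat) (gT : finGroupType) (D : {group gT}) :
    (1 < m)%N -> D \isog Grp (a : b : a ^+ m, b ^+ 2, b^-1 * a * b = a^-1) ->
  exists A : {group gT}, [/\ cyclic A, #|A| = m, A \subset D, #|D| = (2 * m)%N
    & {in D :\: A & A, forall y x, x ^ y = x^-1}].
Proof.
move=> m_gt1 isoD.
(* Relations alone only bound [#|D|] from above; the lower bound comes from the concrete dihedral
   group, which satisfies them and so is an image of [D]. *)
have le_mD: (2 * m <= #|D|)%N.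
  have m_gt0: (0 < m)%N by lia.
  have <-: #|[set: 'D_(2 * m)]| = (2 * m)%N by rewrite mul2n card_dihedral.
  apply: leq_homg; rewrite isoD.
  have: [set: 'D_(m.*2)] \homg Grp (x : y : x ^+ m, y ^+ 2, x ^ y = x^-1).
    by rewrite -Grp_dihedral // homg_refl.
  rewrite mul2n; case/existsP=> -[x y] /= /eqP[defG xm y2 xy].
  by apply/existsP; exists (x, y); rewrite /= defG xm y2 -mulgA -conjgE xy.
have: D \homg Grp (a : b : a ^+ m, b ^+ 2, b^-1 * a * b = a^-1).
  by rewrite -isoD homg_refl.
case/existsP=> -[a b] /= /eqP[defD am b2]; rewrite -mulgA -conjgE => ab.
have nAb: <[b]> \subset 'N(<[a]>).
  by rewrite cycle_subG; apply/normP; rewrite -cycleJ ab cycleV.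
rewrite norm_joinEr // in defD.
have leA: (#[a] <= m)%N by rewrite dvdn_leq ?order_dvdn ?am // ltnW.
have leB: (#[b] <= 2)%N by rewrite dvdn_leq ?order_dvdn ?b2.
have leD: (#|D| <= #[a] * #[b])%N.
  by rewrite -defD mul_cardG leq_pmulr // cardG_gt0.
(* [2 * m <= #|D| <= #[a] * #[b]] with [#[a] <= m] and [#[b] <= 2] forces equality. *)
have oA: #[a] = m by nia.
exists <[a]>%G; split=> //=; first exact: cycle_cyclic.
- by rewrite -defD mulG_subl.
- by apply: anti_leq; rewrite le_mD (leq_trans leD) // oA mulnC leq_mul2r leB orbT.
move=> y x; rewrite inE -defD => /andP[nAy /mulsgP[u v Au Bv def_y]] Ax.
have xu: x ^ u = x.
  by apply/conjg_fixP/commgP/(centsP (cycle_abelian a)).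
rewrite {}def_y conjgM {}xu in nAy *.
(* Only the parity of the exponent of [b] matters; an even one would put [y] in [<[a]>], so [y] acts
   on [x] as [b] does. *)
have /cycleP[i def_v] := Bv; rewrite {Bv}def_v -(expg_mod i b2) modn2 in nAy *.
case: (odd i) nAy => [_ | /negP[]]; last by rewrite mulg1.
by have /cycleP[k ->] := Ax; rewrite expg1 conjXg ab expgVn.
Qed.

Theorem mainTheorem3 (m : nat) (hm : (2 <= m)%N) (hm4 : m != 4)
    (gT : finGroupType) (D : {group gT})
    (hD : D \isog Grp (a : b : a ^+ m, b ^+ 2, b^-1 * a * b = a^-1)) :
  chain_of_length 0 (CD D) /\ exists H : {group gT}, CD D = [set H].
Proof.
suffices [H defCD]: exists H : {group gT}, CD D = [set H].
  split; last by exists H.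
  rewrite /chain_of_length defCD cards1; split=> // K L.
  by rewrite !inE => /eqP-> /eqP->; rewrite subxx.
have [A [cycA oA sAD oD invA]] := dihedral_rotations hm hD.
have [m2 | m_neq2] := eqVneq m 2.
  (* Here [D] has order 4, the square of a prime, hence is abelian. *)
  exists D; apply/abelian_CD/(@p2group_abelian _ 2); first by rewrite /pgroup oD m2.
  by rewrite oD m2.
exists A; apply: CD_eq_set1 => // H.
by apply: cd_measure_lt_inverted; rewrite ?oA ?oD //; lia.
Qed.
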